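(* Let $n\in\mathbb{N}$, $n \ge 1$, and let $\gamma$ be a weight with domain containing $\{0,1,\ldots,n-1\}$ such that either (a) $\gamma_{[0,x]} > 0$ and $\gamma_{[x,n-1]} > 0$ for all $x \in \{0,\ldots,n-1\}$; or (b) $\gamma_{[x,x]} > 0$ for all $x \in \{0,\ldots,n-1\}$ and $\gamma_{[x-1,x]} > 0$ for all non-zero $x \in \{0,\ldots,n-1\}$. Then the $\gamma$-weighted involutive walk on $\{0,\ldots,n-1\}$ is reversible if and only if, on the intervals of $\{0,\ldots,n-1\}$, $\gamma$ factorizes as a pointwise product $\gamma=\alpha\beta$ (that is, $\gamma_{[y,x]}=\alpha_{[y,x]}\beta_{[y,x]}$ for all $x,y$), where $\alpha$ is an atomic weight and $\beta$ is a $\star$-symmetric weight. Moreover, in this case the unique invariant distribution $\pi$ is such that $\pi_x$ is proportional to $\alpha_{x^\star}N(\alpha\beta)_x$.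
   Context: For $x,y\in\mathbb{N}_0$, $[y,x]$ denotes the interval $\{y,y+1,\ldots,x\}\subseteq\mathbb{N}_0$ (empty if $y>x$). A weight with domain $D$, where $D=\mathbb{N}_0$ or $D=\{0,1,\ldots,N-1\}$, is a function $\gamma$ on the set of intervals of $D$, taking non-negative real values $\gamma_{[y,x]}$, with $\gamma_\varnothing = 0$ and $\sum_{y=0}^{x}\gamma_{[y,x]}>0$ for all $x\in D$. Write $\gamma_y=\gamma_{[y,y]}$ and $N(\gamma)_x=\sum_{y=0}^x\gamma_{[y,x]}$. For $x\in\{0,\ldots,n-1\}$ write $x^\star=n-1-x$. A weight $\gamma$ is atomic if $\gamma_{[y,x]}=\gamma_{[y,y]}$ for all $y\le x$ in $\{0,\ldots,n-1\}$, and $\star$-symmetric if $\gamma_{[y,x]}=\gamma_{[x^\star,y^\star]}$ for all $x,y\in\{0,\ldots,n-1\}$. The $\gamma$-weighted involutive walk on $\{0,\ldots,n-1\}$ is the Markov chain in which, from state $x$, one chooses $y\in\{0,\ldots,x\}$ with probability $\gamma_{[y,x]}/N(\gamma)_x$ and steps to $y^\star$. Thus its transition matrix is $P(\gamma)_{xz}=\gamma_{[z^\star,x]}/N(\gamma)_x$. The walk is reversible if it has an invariant probability distribution $\pi$ satisfying the detailed balance equations $\pi_xP(\gamma)_{xz}=\pi_zP(\gamma)_{zx}$ for all $x,z$. (Under (a) or (b) the walk is irreducible with a unique, strictly positive, invariant distribution.) *)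

(* Defs.v *)
From HB Require Import structures.
From mathcomp Require Import all_boot all_order all_algebra.
From mathcomp Require Import reals.

Set Implicit Arguments.
Unset Strict Implicit.
Unset Printing Implicit Defensive.

Import Order.TTheory GRing.Theory Num.Theory.
Local Open Scope ring_scope.

(* [AllNat] is the set of all natural numbers, [Below N] is {0, ..., N - 1}. *)
Variant wdomain := AllNat | Below of nat.

Definition in_dom (D : wdomain) (x : nat) : bool :=
  if D is Below N then (x < N)%N else true.

(* A function on intervals of naturals is encoded as [w : nat -> nat -> R],
   where [w y x] is the value at the interval [y, x]; every pair with [x < y]
   stands for the empty interval. *)
Definition wtotal (R : realType) (w : nat -> nat -> R) (x : nat) : R :=
  \sum_(y < x.+1) w y x.

(* Values at nonempty intervals not contained in [D] are junk: for [y <= x],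
   the interval [y, x] is contained in [D] if and only if [x] is in [D]. *)
Record weight (R : realType) (D : wdomain) := Weight {
  wval :> nat -> nat -> R;
  weight_ge0 : forall y x : nat, (y <= x)%N -> in_dom D x -> 0 <= wval y x;
  weight_empty : forall y x : nat, (x < y)%N -> wval y x = 0;
  weight_total_gt0 : forall x : nat, in_dom D x -> 0 < wtotal wval x }.

Definition wmul (R : realType) (v w : nat -> nat -> R) (y x : nat) : R :=
  v y x * w y x.

Definition atomic (R : realType) (n : nat) (w : nat -> nat -> R) : Prop :=
  forall y x : 'I_n, (y <= x)%N -> w y x = w y y.

(* [rev_ord x] is the element n - 1 - x of ['I_n]. *)
Definition star_symmetric (R : realType) (n : nat) (w : nat -> nat -> R) :
    Prop :=
  forall x y : 'I_n, w y x = w (rev_ord x) (rev_ord y).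

Definition factorization (R : realType) (n : nat)
    (g a b : nat -> nat -> R) : Prop :=
  [/\ atomic n a, star_symmetric n b &
      forall x y : 'I_n, g y x = wmul a b y x].

Definition involutive_walk (R : realType) (n : nat) (w : nat -> nat -> R) :
    'M[R]_n :=
  \matrix_(x < n, z < n) (w (rev_ord z) x / wtotal w x).

Definition invariant_distribution (R : realType) (n : nat) (P : 'M[R]_n)
    (pi : 'rV[R]_n) : Prop :=
  [/\ forall x, 0 <= pi 0 x, \sum_x pi 0 x = 1 & pi *m P = pi].

Definition reversible (R : realType) (n : nat) (P : 'M[R]_n) : Prop :=
  exists2 pi : 'rV[R]_n, invariant_distribution P pi &
    forall x z, pi 0 x * P x z = pi 0 z * P z x.

(* Main.v *)
(** Write [y'] for [n - 1 - y] and [N] for the total weight.  Reversibility and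
factorization are tied together by the formula [alpha_y = pi_y' / N_y']: since
the walk steps from [x] to [z] with probability [gamma_[z', x] / N_x], detailed
balance for [pi] says exactly that [gamma_[y, x] / alpha_y] is star-symmetric.
Dividing by [alpha] requires
[pi > 0], which follows from irreducibility.  For uniqueness, let [mu] be an
invariant distribution and [M] the maximum of [mu / pi]: the invariant vector
[M pi - mu] is nonnegative and vanishes somewhere, so it is zero by
irreducibility. *)

Require Import Defs.
From HB Require Import structures.
From mathcomp Require Import all_boot all_order all_algebra.
From mathcomp Require Import reals ring.

Set Implicit Arguments.
Unset Strict Implicit.
Unset Printing Implicit Defensive.

Import Order.TTheory GRing.Theory Num.Theory.
Local Open Scope ring_scope.

(** * Invariant distributions of irreducible chains *)

Definition irreducible (R : realType) (n : nat) (P : 'M[R]_n) : Prop :=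
  forall S : pred 'I_n, (forall x z, S x -> 0 < P x z -> S z) ->
  forall x z, S x -> S z.

(** The support of [v] is closed under positive transitions: if [v 0 x] and [P x z] are positive,
    they contribute a positive term to the sum giving [v 0 z], and no term is negative. *)
Lemma invariant_gt0 (R : realType) (n : nat) (P : 'M[R]_n) (v : 'rV[R]_n) :
  (forall x z, 0 <= P x z) -> irreducible P ->
  (forall x, 0 <= v 0 x) -> v *m P = v ->
  forall x z, 0 < v 0 x -> 0 < v 0 z.
Proof.
move=> P_ge0 irrP v_ge0 vP; apply: (irrP (fun x => 0 < v 0 x)) => x z vx Pxz.
rewrite -vP mxE (bigD1 x) //= ltr_wpDr ?mulr_gt0 //.
by apply: sumr_ge0 => i _; rewrite mulr_ge0.
Qed.

Lemma invariant_distribution_gt0 (R : realType) (n : nat) (P : 'M[R]_n)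
    (pi : 'rV[R]_n) :
  (forall x z, 0 <= P x z) -> irreducible P -> invariant_distribution P pi ->
  forall x, 0 < pi 0 x.
Proof.
move=> P_ge0 irrP [pi_ge0 pi1 piP] z.
have [x pix] : exists x, 0 < pi 0 x.
  apply/existsP; apply: contraT; rewrite negb_exists => /forallP pi_le0.
  have := oner_neq0 R; rewrite -pi1 big1 ?eqxx // => i _.
  by apply/eqP; rewrite eq_le pi_ge0 andbT leNgt pi_le0.
exact: invariant_gt0 pix.
Qed.

Lemma invariant_distribution_unique (R : realType) (n : nat) (P : 'M[R]_n)
    (pi mu : 'rV[R]_n) :
  (forall x z, 0 <= P x z) -> irreducible P ->
  invariant_distribution P pi -> invariant_distribution P mu -> pi = mu.
Proof.
move=> P_ge0 irrP hpi [mu_ge0 mu1 muP].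
have pi_gt0 := invariant_distribution_gt0 P_ge0 irrP hpi.
have [pi_ge0 pi1 piP] := hpi.
case: n => [|n] in P pi mu P_ge0 irrP hpi mu_ge0 mu1 muP pi_gt0 pi_ge0 pi1 piP *.
  by apply/rowP => -[].
have [m _ mmax] := @arg_maxP _ _ _ ord0 predT (fun x => mu 0 x / pi 0 x) isT.
set M := mu 0 m / pi 0 m in mmax.
pose v := M *: pi - mu.
have v_ge0 x : 0 <= v 0 x.
  by rewrite !mxE subr_ge0 -ler_pdivrMr //; apply: mmax.
have vP : v *m P = v by rewrite mulmxBl -scalemxAl piP muP.
have vm : v 0 m = 0 by rewrite !mxE divfK ?subrr // gt_eqF.
have v0 x : v 0 x = 0.
  apply/eqP; rewrite eq_le v_ge0 andbT leNgt; apply/negP => vx.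
  by have := invariant_gt0 P_ge0 irrP v_ge0 vP m vx; rewrite vm ltxx.
have mu_pi : mu = M *: pi.
  by apply/rowP => x; have /eqP := v0 x; rewrite !mxE subr_eq0 => /eqP.
(* Compare total masses: those of [mu] and [pi] are both 1. *)
have M1 : M = 1.
  rewrite -mu1 mu_pi -[LHS]mulr1 -pi1 mulr_sumr.
  by apply: eq_bigr => x _; rewrite !mxE.
by rewrite mu_pi M1 scale1r.
Qed.

Lemma detailed_balance_invariant (R : realType) (n : nat) (P : 'M[R]_n)
    (pi : 'rV[R]_n) :
  (forall x, \sum_z P x z = 1) ->
  (forall x z, pi 0 x * P x z = pi 0 z * P z x) -> pi *m P = pi.
Proof.
move=> P1 db; apply/rowP => x; rewrite mxE.
under eq_bigr do rewrite db.
by rewrite -mulr_sumr P1 mulr1.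
Qed.

(** * The walk as an irreducible stochastic matrix *)

Definition proper_weight (R : realType) (n : nat) (g : nat -> nat -> R) : Prop :=
  [/\ forall y x : 'I_n, 0 <= g y x,
      forall y x, (x < y)%N -> g y x = 0 &
      forall x : 'I_n, 0 < wtotal g x].

Definition walk_condition (R : realType) (n : nat) (g : nat -> nat -> R) : Prop :=
  (forall x : 'I_n, 0 < g 0%N x /\ 0 < g x n.-1)
  \/ ((forall x : 'I_n, 0 < g x x)
      /\ (forall x : 'I_n, (x != 0 :> nat)%N -> 0 < g x.-1 x)).

(** Discards the domain [D], so that the lemmas on the walk apply to a bare function. *)
Lemma weight_proper (R : realType) (n : nat) (D : wdomain) (g : weight R D) :
  (forall x : 'I_n, in_dom D x) -> proper_weight n g.
Proof.
move=> subD; split=> [y x|y x|x]; last exact: weight_total_gt0.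
  by case: (leqP y x) => [le_yx|/weight_empty->//]; exact: weight_ge0.
exact: weight_empty.
Qed.

(** The added terms belong to empty intervals. A sum over all of ['I_n] can be reindexed by
    [rev_ord]. *)
Lemma wtotal_ord (R : realType) (n : nat) (g : nat -> nat -> R) (x : 'I_n) :
  (forall y x, (x < y)%N -> g y x = 0) -> wtotal g x = \sum_(y < n) g y x.
Proof.
move=> g0; rewrite /wtotal -[RHS](big_mkord predT (g^~ x)).
rewrite (big_cat_nat (leq0n x.+1) (ltn_ord x)) /= big_mkord.
rewrite [X in _ + X]big_nat_cond [X in _ + X]big1 ?addr0 //.
by move=> i /andP[/andP[/g0]].
Qed.

Lemma walk_ge0 (R : realType) (n : nat) (g : nat -> nat -> R) :
  proper_weight n g -> forall x z, 0 <= involutive_walk n g x z.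
Proof. by move=> [g_ge0 _ N_gt0] x z; rewrite mxE divr_ge0 // ltW. Qed.

Lemma walk_sum (R : realType) (n : nat) (g : nat -> nat -> R) :
  proper_weight n g -> forall x, \sum_z involutive_walk n g x z = 1.
Proof.
move=> [_ g0 N_gt0] x; under eq_bigr do rewrite mxE.
rewrite -mulr_suml -(reindex_inj (P := predT) (F := fun z : 'I_n => g z x) rev_ord_inj) /=.
by rewrite -wtotal_ord // divff // gt_eqF.
Qed.

(** Under the first alternative, choosing [0] leads from any state to [n - 1], and from there every
    state is one step away. Under the second, each state steps to its reflection, and a nonzero
    state also to the reflection of its predecessor; combining the two moves down or up by one. *)
Lemma walk_irreducible (R : realType) (n : nat) (g : nat -> nat -> R) :
  proper_weight n g -> walk_condition n g -> irreducible (involutive_walk n g).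
Proof.
move=> [_ _ N_gt0] hg S closed.
have step (x y : 'I_n) : S x -> 0 < g y x -> S (rev_ord y).
  by move=> Sx gyx; apply: closed Sx _; rewrite mxE rev_ordK divr_gt0.
case: n => [|n] in S closed N_gt0 hg step *; first by case.
case: hg => [ga|[gb0 gb1]] x z Sx.
  have Sm : S ord_max.
    suff -> : ord_max = rev_ord ord0 :> 'I_n.+1.
      by apply: (step x) => //; case: (ga x).
    by apply: val_inj; rewrite /= subn1.
  by rewrite -(rev_ordK z); apply: (step ord_max) => //; case: (ga (rev_ord z)).
have rev y : S y -> S (rev_ord y) by move=> Sy; apply: step (gb0 y).
have pred_rev (y y' : 'I_n.+1) : y = y'.+1 :> nat -> S y -> S (rev_ord y').
  move=> yy' Sy; apply: step Sy _.
  by have := gb1 y; rewrite yy' => ->.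
have down (y y' : 'I_n.+1) : y = y'.+1 :> nat -> S y -> S y'.
  by move=> yy' Sy; rewrite -(rev_ordK y'); apply/rev/(pred_rev y).
(* As [rev_ord] reverses the order, [rev_ord y'] is the predecessor of [rev_ord y], so reflecting
   first moves up. *)
have up (y y' : 'I_n.+1) : y' = y.+1 :> nat -> S y -> S y'.
  move=> yy' Sy; rewrite -(rev_ordK y'); apply: (pred_rev (rev_ord y)); last exact: rev.
  by rewrite /= !subSS yy' subnSK // -ltnS -yy'.
(* Descend to [0], then climb from there to any state. *)
have S0 k (y : 'I_n.+1) : y = k :> nat -> S y -> S ord0.
  elim: k y => [|k IHk] y yk Sy; first by rewrite -(_ : y = ord0) //; exact: val_inj.
  have lt_k : (k < n.+1)%N by rewrite ltnW // -yk.
  by apply: (IHk (Ordinal lt_k)) => //; apply: (down y).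
have Sk k (y : 'I_n.+1) : y = k :> nat -> S y.
  elim: k y => [|k IHk] y yk.
    by rewrite (_ : y = ord0); [exact: (S0 x x) | exact: val_inj].
  have lt_k : (k < n.+1)%N by rewrite ltnW // -yk.
  by apply: (up (Ordinal lt_k)) => //; apply: IHk.
exact: Sk erefl.
Qed.

(** * Reversibility and factorization *)

Lemma factorization_atom_gt0 (R : realType) (n : nat) (g : nat -> nat -> R)
    (a b : weight R (Below n)) :
  walk_condition n g -> factorization n g a b -> forall y : 'I_n, 0 < a y y.
Proof.
move=> hg [a_atom _ gab] y.
(* By atomicity [a y y] is a factor of every [g y x] with [y <= x], so one positive such value
   suffices. *)
suff [x le_yx gyx] : exists2 x : 'I_n, (y <= x)%N & 0 < g y x.
  rewrite lt_def weight_ge0 //= ?ltn_ord // andbT; apply: contraTneq gyx => ay0.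
  by rewrite gab /wmul a_atom // ay0 mul0r ltxx.
case: hg => [ga|[gb _]]; last by exists y.
case: n => [|n] in a b a_atom gab y ga *; first by case: y.
by exists ord_max; [rewrite -ltnS | case: (ga y)].
Qed.

Lemma reversible_factorization (R : realType) (n : nat) (g : nat -> nat -> R) :
  proper_weight n g -> walk_condition n g -> reversible (involutive_walk n g) ->
  exists (a b : weight R (Below n)), factorization n g a b.
Proof.
move=> gw hg [pi hpi db].
have pi_gt0 :=
  invariant_distribution_gt0 (walk_ge0 gw) (walk_irreducible gw hg) hpi.
have [g_ge0 g0 N_gt0] := gw.
case: n => [|n] in g gw hg pi hpi db pi_gt0 g_ge0 g0 N_gt0 *.
  have weight0 : weight R (Below 0).
    by exists (fun _ _ => 0).
  by exists weight0, weight0; split=> -[].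
(* Outside ['I_n.+1], [inord] takes the default value [ord0], so [a0] is positive at every natural
   number. *)
pose a0 (y : nat) : R :=
  let z : 'I_n.+1 := rev_ord (inord y) in pi 0 z / wtotal g z.
have a0_gt0 y : 0 < a0 y by rewrite divr_gt0.
have a0E (y : 'I_n.+1) : a0 y = pi 0 (rev_ord y) / wtotal g (rev_ord y).
  by rewrite /a0 inord_val.
(* [a] must be cut off on empty intervals; [b] inherits its zeros there from [g]. *)
pose a (y x : nat) : R := if (y <= x)%N then a0 y else 0.
pose b (y x : nat) : R := g y x / a0 y.
have b_total x : (x < n.+1)%N -> 0 < wtotal b x.
  move=> lt_x; have lt_y (y : 'I_x.+1) : (y < n.+1)%N by exact: leq_trans lt_x.
  have g_ge0' (y : 'I_x.+1) : 0 <= g y x := g_ge0 (Ordinal (lt_y y)) (Ordinal lt_x).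
  have b_ge0 (y : 'I_x.+1) : 0 <= b y x by rewrite divr_ge0 // ltW.
  rewrite lt_def sumr_ge0 // andbT; apply/negP => /eqP/psumr_eq0P b_eq0.
  have := N_gt0 (Ordinal lt_x); rewrite /wtotal big1 ?ltxx //= => y _.
  have /eqP := b_eq0 (fun i _ => b_ge0 i) y isT.
  by rewrite mulf_eq0 invr_eq0 (gt_eqF (a0_gt0 _)) orbF => /eqP.
have aw : forall x, in_dom (Below n.+1) x -> 0 < wtotal a x.
  move=> x _; rewrite /wtotal big_ord_recr /= ltr_wpDl //; last by rewrite /a leqnn.
  by apply: sumr_ge0 => i _; rewrite /a; case: ifP => // _; exact: ltW.
have a_ge0 y x : (y <= x)%N -> in_dom (Below n.+1) x -> 0 <= a y x.
  by rewrite /a => -> _; exact: ltW.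
have a_empty y x : (x < y)%N -> a y x = 0 by rewrite /a ltnNge => /negbTE->.
have b_ge0 y x : (y <= x)%N -> in_dom (Below n.+1) x -> 0 <= b y x.
  move=> le_yx lt_x; apply: divr_ge0 (ltW (a0_gt0 _)).
  exact: (g_ge0 (Ordinal (leq_ltn_trans le_yx lt_x)) (Ordinal lt_x)).
have b_empty y x : (x < y)%N -> b y x = 0 by move=> /g0; rewrite /b => ->; rewrite mul0r.
exists (Weight a_ge0 a_empty aw), (Weight b_ge0 b_empty b_total).
split=> [y x le_yx|x y|x y].
- by rewrite /= /a le_yx leqnn.
- change (b y x = b (rev_ord x) (rev_ord y)).
  (* The walk goes from [x] to [rev_ord y] through [[y, x]] and back through
     [[rev_ord x, rev_ord y]], the two intervals to compare. *)
  have := db x (rev_ord y); rewrite !mxE rev_ordK /b !a0E rev_ordK => dbxy.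
  have pix := pi_gt0 x; have piy := pi_gt0 (rev_ord y).
  have Nx := N_gt0 x; have Ny := N_gt0 (rev_ord y).
  (* Multiplying by both quotients of [pi] by the total turns the goal into this balance
     equation. *)
  rewrite !invf_div; apply: (mulIf (lt0r_neq0 (divr_gt0 piy Ny))).
  apply: (mulIf (lt0r_neq0 (divr_gt0 pix Nx))).
  transitivity (pi 0 x * (g y x / wtotal g x)); last rewrite dbxy; field;
    by rewrite !lt0r_neq0.
- rewrite /wmul /= /a /b; case: leqP => [_|/g0->]; last by rewrite mul0r.
  by rewrite mulrC divfK ?lt0r_neq0.
Qed.

(** In the flow from [x] to [z] the total cancels, leaving the atoms of [a] at both reflected states
    times [b (rev_ord z) x]. This is symmetric in [x] and [z], which gives detailed balance and
    hence invariance. *)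
Lemma factorization_invariant (R : realType) (n : nat) (g : nat -> nat -> R)
    (a b : weight R (Below n)) :
  (0 < n)%N -> proper_weight n g -> walk_condition n g ->
  factorization n g a b ->
  exists pi : 'rV[R]_n,
    [/\ invariant_distribution (involutive_walk n g) pi,
        forall x z, pi 0 x * involutive_walk n g x z
                    = pi 0 z * involutive_walk n g z x &
        exists2 c : R, 0 < c &
          forall x : 'I_n, pi 0 x = c * (a (rev_ord x) (rev_ord x)
                                         * wtotal (wmul a b) x)].
Proof.
move=> n_gt0 gw hg fab; have a_gt0 := factorization_atom_gt0 hg fab.
have [a_atom b_sym gab] := fab; have [g_ge0 g0 N_gt0] := gw.
have Nab (x : 'I_n) : wtotal (wmul a b) x = wtotal g x.
  apply: eq_bigr => y _.
  exact/esym/(gab x (Ordinal (leq_trans (ltn_ord y) (ltn_ord x)))).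
pose m (x : 'I_n) := a (rev_ord x) (rev_ord x) * wtotal g x.
have m_gt0 x : 0 < m x by rewrite mulr_gt0.
have Z_gt0 : 0 < \sum_x m x.
  rewrite (bigD1 (Ordinal n_gt0)) //= ltr_wpDr //.
  by apply: sumr_ge0 => i _; exact: ltW.
pose c := (\sum_x m x)^-1.
have c_gt0 : 0 < c by rewrite invr_gt0.
pose pi : 'rV[R]_n := \row_x (c * m x).
have flow x z : pi 0 x * involutive_walk n g x z =
    c * (a (rev_ord x) (rev_ord x) * a (rev_ord z) (rev_ord z) * b (rev_ord z) x).
  rewrite !mxE /m -!mulrA; congr (_ * (_ * _)).
  rewrite mulrC divfK ?lt0r_neq0 // gab /wmul.
  (* Atomicity covers nonempty intervals only; on empty ones [b] makes both sides zero. *)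
  have [le_zx|lt_xz] := leqP (rev_ord z) x; first by rewrite a_atom.
  by rewrite [b _ _]weight_empty // !mulr0.
have db x z : pi 0 x * involutive_walk n g x z = pi 0 z * involutive_walk n g z x.
  by rewrite !flow b_sym rev_ordK [a (rev_ord x) _ * _]mulrC.
exists pi; split=> //; last by exists c => // x; rewrite mxE Nab.
split=> [x||].
- by rewrite mxE mulr_ge0 // ltW.
- under eq_bigr do rewrite mxE.
  by rewrite -mulr_sumr mulVf ?lt0r_neq0.
- exact: detailed_balance_invariant (walk_sum gw) db.
Qed.

Theorem theorem1p4 (R : realType) (n : nat) (n_gt0 : (0 < n)%N)
    (D : wdomain) (subD : forall x : 'I_n, in_dom D x) (gamma : weight R D)
    (hgamma :
       (forall x : 'I_n, 0 < gamma 0%N x /\ 0 < gamma x n.-1)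
       \/ ((forall x : 'I_n, 0 < gamma x x)
           /\ (forall x : 'I_n, (x != 0 :> nat)%N -> 0 < gamma x.-1 x))) :
  (reversible (involutive_walk n gamma) <->
     exists (alpha : weight R (Below n)) (beta : weight R (Below n)),
       factorization n gamma alpha beta)
  /\ (forall (alpha : weight R (Below n)) (beta : weight R (Below n)),
        factorization n gamma alpha beta ->
        exists pi : 'rV[R]_n,
          unique (invariant_distribution (involutive_walk n gamma)) pi
          /\ exists2 c : R, 0 < c &
               forall x : 'I_n,
                 pi 0 x = c * (alpha (rev_ord x) (rev_ord x)
                               * wtotal (wmul alpha beta) x)).
Proof.
have gw := weight_proper gamma subD.
split; first split.
- exact: reversible_factorization.
- move=> [alpha [beta /(factorization_invariant n_gt0 gw hgamma)]].
  by move=> [pi [pi_inv db _]]; exists pi.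
- move=> alpha beta /(factorization_invariant n_gt0 gw hgamma)[pi [pi_inv _ hc]].
  exists pi; split=> //; split=> // mu.
  apply: invariant_distribution_unique => //; first exact: walk_ge0.
  exact: walk_irreducible.
Qed.
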